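(* Fix $q\in[0,1)$ and $c=1/(2\ln 2)$. For each number of qubits $n$, consider an $L$-layered ansatz ($L=L(n)$) with parameter generators $H_{lm}=\sum_i\eta_{lm}^i\sigma_n^i$ and an observable $O=\sum_j\omega^j\sigma_n^j$, and let $$F(n)=\sqrt{8\ln 2}\;N_O\,\|\boldsymbol\omega\|_\infty\,\|\boldsymbol\eta_{lm}\|_1\,n^{1/2}\,q^{cL+1}$$ be the upper bound on the magnitude of the partial derivative, with respect to $\theta_{lm}$, of the noisy cost function with local Pauli noise of parameter $q$ before and after each layer. Suppose $N_{lm},N_O\in\mathcal O(\mathrm{poly}(n))$ and $\eta_{lm}^i,\omega^j\in\mathcal O(\mathrm{poly}(n))$ for all $i,j$ (i.e. their absolute values are bounded by a polynomial in $n$, uniformly in $i,j$). If $L\in\Omega(n)$, then there is a constant $\alpha>0$ such that $$F(n)\in\mathcal O(2^{-\alpha n}).$$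
   Context: The $\sigma_n^i$ range over the $n$-qubit Pauli strings in $\{\mathbb 1,X,Y,Z\}^{\otimes n}$; $\boldsymbol\omega$ and $\boldsymbol\eta_{lm}$ are the real Pauli-coefficient vectors of $O$ and $H_{lm}$; $N_O$ and $N_{lm}$ are their numbers of nonzero entries; $\|\boldsymbol\omega\|_\infty=\max_i|\omega^i|$ and $\|\boldsymbol\eta_{lm}\|_1=\sum_i|\eta_{lm}^i|$. Here the ansatz is $U(\boldsymbol\theta)=U_L(\boldsymbol\theta_L)\cdots U_1(\boldsymbol\theta_1)$ with $U_l(\boldsymbol\theta_l)=\prod_m e^{-i\theta_{lm}H_{lm}}W_{lm}$, $W_{lm}$ fixed unitaries. The noise is a tensor product of single-qubit channels $\mathcal N_j$ with $\mathcal N_j(\mathbb 1)=\mathbb 1$, $\mathcal N_j(\sigma)=q_\sigma\sigma$ for $\sigma\in\{X,Y,Z\}$, and $q=\max\{|q_X|,|q_Y|,|q_Z|\}$, independent of $n$. *)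

(* Defs.v *)
From HB Require Import structures.
From mathcomp Require Import all_boot all_order all_algebra.
From mathcomp Require Import all_classical all_reals all_analysis.
From mathcomp Require Import complex mxtens.

Set Implicit Arguments.
Unset Strict Implicit.
Unset Printing Implicit Defensive.

Import Order.TTheory GRing.Theory Num.Theory.
Import numFieldNormedType.Exports.

Local Open Scope classical_set_scope.
Local Open Scope ring_scope.
Local Open Scope complex_scope.

Inductive pauli := PauliI | PauliX | PauliY | PauliZ.

Definition ord_of_pauli (p : pauli) : 'I_4 :=
  match p with
  | PauliI => inord 0 | PauliX => inord 1 | PauliY => inord 2 | PauliZ => inord 3
  end.

Definition pauli_of_ord (i : 'I_4) : pauli :=
  match val i with
  | 0%N => PauliI | 1%N => PauliX | 2%N => PauliY | _ => PauliZ
  end.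

Lemma ord_of_pauliK : cancel ord_of_pauli pauli_of_ord.
Proof. by case; rewrite /pauli_of_ord /= inordK. Qed.

HB.instance Definition _ := Finite.copy pauli (can_type ord_of_pauliK).

Notation pauli_string n := {ffun 'I_n -> pauli}.

Section Defs.
Variable R : realType.

Definition pauli_mx (p : pauli) : 'M[R[i]]_2 :=
  match p with
  | PauliI => 1%:M
  | PauliX => \matrix_(a, b) (a != b)%:R
  | PauliY => \matrix_(a, b) (if a == b then 0 else if a == 0 then - 'i else 'i)
  | PauliZ => \matrix_(a, b) (if a == b then (-1) ^+ a else 0)
  end.

(* A 0 ⊗ ... ⊗ A (n - 1); the cast is along 2 ^ n.+1 = 2 * 2 ^ n. *)
Fixpoint tensor_prod (n : nat) : ('I_n -> 'M[R[i]]_2) -> 'M[R[i]]_(2 ^ n) :=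
  match n with
  | 0 => fun=> 1%:M
  | n'.+1 => fun A =>
      castmx (esym (expnS 2 n'), esym (expnS 2 n'))
        (A ord0 *t tensor_prod (fun k : 'I_n' => A (lift ord0 k)))
  end.

Definition pauli_string_mx (n : nat) (s : pauli_string n) : 'M[R[i]]_(2 ^ n) :=
  tensor_prod (fun k => pauli_mx (s k)).

Definition pauli_comb (n : nat) (x : pauli_string n -> R) : 'M[R[i]]_(2 ^ n) :=
  \sum_s (x s)%:C *: pauli_string_mx s.

Definition num_terms (n : nat) (x : pauli_string n -> R) : nat :=
  #|[set s | x s != 0]%SET|.

Definition norm1 (n : nat) (x : pauli_string n -> R) : R := \sum_s `|x s|.

(* The default 0 does not affect the maximum: the entries are nonnegative. *)
Definition norm_infty (n : nat) (x : pauli_string n -> R) : R :=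
  \big[Num.max/0]_s `|x s|.

Definition c_const : R := 1 / (2 * ln 2).

(* Upper bound on the modulus of the partial derivative of the noisy cost with
   respect to theta_lm, for an L-layered ansatz exposed to local Pauli noise of
   strength q = max(|q_X|, |q_Y|, |q_Z|) before and after each layer; eta and
   omega are the Pauli coefficients of the generator H_lm and of the observable. *)
Definition deriv_bound (n : nat) (q : R) (L : nat)
    (eta omega : pauli_string n -> R) : R :=
  Num.sqrt (8 * ln 2) * (num_terms omega)%:R * norm_infty omega * norm1 eta
  * n%:R `^ (1 / 2) * q `^ (c_const * L%:R + 1).

Definition bigO_poly (f : nat -> R) : Prop :=
  exists p : {poly R}, f =O_\oo (fun n => p.[n%:R]).

(* One polynomial bounds all the coefficients at once. *)
Definition coef_bigO_poly (x : forall n, pauli_string n -> R) : Prop :=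
  exists p : {poly R},
    \forall n \near \oo, forall s : pauli_string n, `|x n s| <= p.[n%:R].

End Defs.

(* Main.v *)
(* Every factor of the bound other than the power of q grows subexponentially,
   while q < 1 and L n >= k n make q `^ (c L n + 1) at most expR (- b n) with
   b > 0; half of b absorbs the subexponential factors. *)
Require Import Defs.
From mathcomp Require Import all_boot all_order all_algebra.
From mathcomp Require Import all_classical all_reals all_analysis.
From mathcomp Require Import complex.
From mathcomp Require Import lra.

Set Implicit Arguments.
Unset Strict Implicit.
Unset Printing Implicit Defensive.

Import Order.TTheory GRing.Theory Num.Theory.
Import numFieldNormedType.Exports.

Local Open Scope classical_set_scope.
Local Open Scope ring_scope.

(** Since every rate [b] is allowed, with [K] depending on [b], the class is closed under products,
    and a rate below any given exponential decay can be picked at the end. *)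
Definition subexponential (R : realType) (f : nat -> R) : Prop :=
  forall b : R, 0 < b ->
  exists K : R, \forall n \near \oo, `|f n| <= K * expR (b * n%:R).

Section Subexponential.
Variable R : realType.
Implicit Types f g : nat -> R.

Lemma subexponential_le f g (K : R) :
  (\forall n \near \oo, `|f n| <= K * `|g n|) ->
  subexponential g -> subexponential f.
Proof.
(* [K] may be negative, so [|K|] is what can multiply the bound on [g]. *)
move=> fg gS b b0; have [C gC] := gS b b0; exists (`|K| * C).
near=> n.
have fgn : `|f n| <= K * `|g n| by near: n.
have gCn : `|g n| <= C * expR (b * n%:R) by near: n.
rewrite -mulrA (le_trans fgn)// (@le_trans _ _ (`|K| * `|g n|))//.
  by rewrite ler_wpM2r// ler_norm.
by rewrite ler_wpM2l.
Unshelve. all: by end_near. Qed.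

Lemma subexponential_cst (c : R) : subexponential (fun=> c).
Proof.
move=> b b0; exists `|c|; near=> n.
by rewrite ler_peMr// -[1]expR0 ler_expR mulr_ge0// ltW.
Unshelve. all: by end_near. Qed.

Lemma subexponential_natr : subexponential (fun n => n%:R : R).
Proof.
(* The witness comes from b n <= 1 + b n <= exp (b n). *)
move=> b b0; exists b^-1; near=> n.
rewrite ger0_norm// ler_pdivlMl//.
by rewrite (le_trans _ (expR_ge1Dx _))// lerDr.
Unshelve. all: by end_near. Qed.

(** Each factor is granted half of the rate, and the two exponentials multiply back to rate [b]. *)
Lemma subexponentialM f g :
  subexponential f -> subexponential g -> subexponential (fun n => f n * g n).
Proof.
move=> fS gS b b0; have b20 : 0 < b / 2 by rewrite divr_gt0.
have [C fC] := fS _ b20; have [D gD] := gS _ b20.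
exists (C * D); near=> n.
rewrite [b in expR (b * _)](splitr b) mulrDl expRD mulrACA normrM.
by apply: ler_pM => //; near: n.
Unshelve. all: by end_near. Qed.

Lemma subexponentialD f g :
  subexponential f -> subexponential g -> subexponential (fun n => f n + g n).
Proof.
move=> fS gS b b0.
have [C fC] := fS _ b0; have [D gD] := gS _ b0.
exists (C + D); near=> n.
rewrite mulrDl (le_trans (ler_normD _ _))// lerD//; by near: n.
Unshelve. all: by end_near. Qed.

Lemma subexponential_horner (p : {poly R}) :
  subexponential (fun n => p.[n%:R]).
Proof.
elim/poly_ind: p => [|p c IHp].
  rewrite (_ : (fun _ => _) = fun=> 0); first exact: subexponential_cst.
  by apply/funext => n; rewrite horner0.
rewrite (_ : (fun _ => _) = fun n => p.[n%:R] * n%:R + c).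
  apply: subexponentialD (subexponential_cst _).
  exact: subexponentialM IHp subexponential_natr.
by apply/funext => n; rewrite hornerMXaddC.
Qed.

Lemma subexponential_bigO_poly f : bigO_poly f -> subexponential f.
Proof.
move=> [p /eqO_exP[K _ fp]].
exact: subexponential_le fp (subexponential_horner p).
Qed.

Lemma subexponential_sqrt : subexponential (fun n => n%:R `^ (1 / 2) : R).
Proof.
apply: (@subexponential_le _ (fun n => n%:R) 1) subexponential_natr.
near=> n.
(* From n = 1 on, lowering the exponent from 1 to 1/2 can only decrease the power. *)
have n1 : 1 <= n%:R :> R by rewrite ler1n; near: n; exists 1%N.
rewrite [leRHS]mul1r ger0_norm ?powR_ge0// ger0_norm//.
by apply: ler1_powR => //; lra.
Unshelve. all: by end_near. Qed.

Lemma norm1_ge0 n (x : pauli_string n -> R) : 0 <= norm1 x.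
Proof. by apply: sumr_ge0. Qed.

(** Only the nonzero entries contribute. Counting them, rather than all 4^n strings, is what keeps
    the 1-norm polynomial in n. *)
Lemma norm1_le n (x : pauli_string n -> R) (C : R) :
  (forall s, `|x s| <= C) -> norm1 x <= (num_terms x)%:R * C.
Proof.
move=> xC; rewrite /norm1 /num_terms.
rewrite (bigID (fun s => x s != 0))/= [X in _ + X]big1 => [|s].
  rewrite addr0; apply: le_trans (ler_sum _ (fun s _ => xC s)) _.
  rewrite (eq_bigl [in [set s | x s != 0]%SET]) => [|s].
    by rewrite sumr_const mulr_natl.
  by rewrite finset.in_set.
by rewrite negbK => /eqP ->; rewrite normr0.
Qed.

Lemma norm_infty_ge0 n (x : pauli_string n -> R) : 0 <= norm_infty x.
Proof. exact: bigmax_ge_id. Qed.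

Lemma norm_infty_le n (x : pauli_string n -> R) (C : R) :
  0 <= C -> (forall s, `|x s| <= C) -> norm_infty x <= C.
Proof. by move=> C0 xC; apply: bigmax_le. Qed.

Lemma subexponential_norm_infty (x : forall n, pauli_string n -> R) :
  coef_bigO_poly x -> subexponential (fun n => norm_infty (x n)).
Proof.
move=> [p xp].
apply: (@subexponential_le _ _ 1) (subexponential_horner p).
near=> n.
(* The bound used is the absolute value of p(n), whose nonnegativity also dominates the default 0 of
   the maximum. *)
rewrite mul1r ger0_norm ?norm_infty_ge0// norm_infty_le// => s.
by rewrite (le_trans _ (ler_norm _))//; move: s; near: n.
Unshelve. all: by end_near. Qed.

Lemma subexponential_norm1 (x : forall n, pauli_string n -> R) :
  bigO_poly (fun n => (num_terms (x n))%:R : R) -> coef_bigO_poly x ->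
  subexponential (fun n => norm1 (x n)).
Proof.
move=> /subexponential_bigO_poly xN [p xp].
apply: (@subexponential_le _ _ 1)
  (subexponentialM xN (subexponential_horner p)).
near=> n.
rewrite mul1r ger0_norm ?norm1_ge0// normrM [`|_%:R|]ger0_norm//.
rewrite norm1_le// => s.
by rewrite (le_trans _ (ler_norm _))//; move: s; near: n.
Unshelve. all: by end_near. Qed.

Lemma c_const_gt0 : 0 < c_const R.
Proof. by rewrite divr_gt0// mulr_gt0// ln_gt0// ltr1n. Qed.

Lemma powR_layers_le (q : R) (L : nat -> nat) :
  0 <= q -> q < 1 ->
  (fun n => (L n)%:R : R) \is 'Omega_\oo (fun n => n%:R : R) ->
  exists2 b : R, 0 < b &
    \forall n \near \oo, q `^ (c_const R * (L n)%:R + 1) <= expR (- b * n%:R).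
Proof.
move=> q0 q1; rewrite qualifE => /asboolP[k k0 kL].
(* The maximum with 1 / 2 covers the case q = 0, where ln is a junk value. *)
pose r := Num.max q (1 / 2).
have r0 : 0 < r by rewrite lt_max divr_gt0 ?orbT.
have r1 : r < 1 by rewrite gt_max q1; lra.
(* This rate is read off from r^(c k n) = exp (c k n ln r); it is positive because 0 < r < 1. *)
exists (c_const R * k * - ln r).
  apply: mulr_gt0; first by rewrite mulr_gt0 ?c_const_gt0.
  by rewrite oppr_gt0 ln_lt0// r0.
near=> n.
have kLn : k * n%:R <= (L n)%:R.
  have : k * `|n%:R : R| <= `|(L n)%:R : R| by near: n.
  by rewrite !ger0_norm.
have c0 := ltW c_const_gt0.
have e0 : 0 <= c_const R * (L n)%:R + 1 by rewrite addr_ge0// mulr_ge0.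
apply: (@le_trans _ _ (r `^ (c_const R * (L n)%:R + 1))).
  by apply: ge0_ler_powR => //; rewrite ?nnegrE ?(ltW r0)// le_max lexx.
(* For a base below 1 a smaller exponent gives a larger power, and c k n <= c L + 1. *)
apply: (@le_trans _ _ (r `^ (c_const R * (k * n%:R)))).
  apply: ger_powR; first by rewrite r0 ltW.
  by rewrite -[leLHS]addr0 lerD// ler_wpM2l.
by rewrite /powR gt_eqF// ler_expR mulrN opprK !mulrA mulrAC.
Unshelve. all: by end_near. Qed.

End Subexponential.

Theorem corollary1 (R : realType) (q : R) (hq0 : 0 <= q) (hq1 : q < 1)
  (* L n layers, with M n l parameters in layer l *)
  (L : nat -> nat) (M : nat -> nat -> nat)
  (H : forall n : nat, nat -> nat -> 'M[R[i]]_(2 ^ n))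
  (O : forall n : nat, 'M[R[i]]_(2 ^ n))
  (eta : forall n : nat, nat -> nat -> pauli_string n -> R)
  (omega : forall n : nat, pauli_string n -> R)
  (hH : forall n l m : nat, (l < L n)%N -> (m < M n l)%N ->
     H n l m = pauli_comb (eta n l m))
  (hO : forall n : nat, O n = pauli_comb (omega n))
  (* the parameter theta_(l n, m n) with respect to which one differentiates *)
  (l m : nat -> nat)
  (hl : forall n : nat, (0 < n)%N -> (l n < L n)%N)
  (hm : forall n : nat, (0 < n)%N -> (m n < M n (l n))%N)
  (hNlm : bigO_poly (fun n => (num_terms (eta n (l n) (m n)))%:R : R))
  (hNO : bigO_poly (fun n => (num_terms (omega n))%:R : R))
  (heta : coef_bigO_poly (fun n => eta n (l n) (m n)))
  (homega : coef_bigO_poly omega)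
  (hL : (fun n => (L n)%:R : R) \is 'Omega_\oo (fun n => n%:R : R)) :
  exists2 alpha : R, 0 < alpha &
    (fun n => deriv_bound q (L n) (eta n (l n) (m n)) (omega n))
      =O_\oo (fun n => 2 `^ (- alpha * n%:R)).
Proof.
have [b b0 qb] := powR_layers_le hq0 hq1 hL.
have b20 : 0 < b / 2 by rewrite divr_gt0.
have ln2_gt0 : 0 < ln 2 :> R by rewrite ln_gt0// ltr1n.
pose g n := Num.sqrt (8 * ln 2) * (num_terms (omega n))%:R
  * norm_infty (omega n) * norm1 (eta n (l n) (m n)) * n%:R `^ (1 / 2) : R.
have gS : subexponential g.
  apply: subexponentialM (@subexponential_sqrt R).
  apply: subexponentialM (subexponential_norm1 hNlm heta).
  apply: subexponentialM (subexponential_norm_infty homega).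
  apply: subexponentialM (subexponential_bigO_poly hNO).
  exact: subexponential_cst.
have [K gK] := gS _ b20.
(* Dividing by ln 2 converts the base: 2^(- alpha n) = exp (- (b / 2) n). *)
exists (b / 2 / ln 2); first by rewrite divr_gt0.
(* The constant must be positive, while [K] may be zero or negative. *)
apply/eqO_exP; exists (`|K| + 1); first by rewrite ltr_wpDl.
near=> n.
have gKn : `|g n| <= K * expR (b / 2 * n%:R) by near: n.
have qbn : q `^ (c_const R * (L n)%:R + 1) <= expR (- b * n%:R) by near: n.
rewrite /deriv_bound -/(g n) normrM [`|_ `^ _|]ger0_norm ?powR_ge0//.
have -> : 2 `^ (- (b / 2 / ln 2) * n%:R) = expR (- (b / 2) * n%:R) :> R.
  rewrite /powR pnatr_eq0/=; congr expR.
  by rewrite -mulNr mulrAC divfK// gt_eqF.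
rewrite [`|expR _|]ger0_norm ?expR_ge0//.
(* Growth at rate b / 2 against decay at rate b leaves decay at rate b / 2. *)
apply: le_trans (ler_pM (normr_ge0 _) (powR_ge0 _ _) gKn qbn) _.
rewrite -[leLHS]mulrA -expRD (_ : b / 2 * n%:R + - b * n%:R = - (b / 2) * n%:R).
  by rewrite ler_wpM2r ?expR_ge0// (le_trans (ler_norm K))// lerDl.
by rewrite -mulrDl; congr (_ * _); lra.
Unshelve. all: by end_near. Qed.
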